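(* Let $A\in\mathbb{R}^{n\times n}$, $B\in\mathbb{R}^{n\times m}$, $F\in\mathbb{R}^{r\times n}$, and $R\in\mathbb{R}^{(n_0-r)\times n}$ with $r<n_0\le n$, such that $\begin{pmatrix} F \\ R \end{pmatrix}\in\mathbb{R}^{n_0\times n}$ has full row rank, and let $\begin{pmatrix} F \\ R \end{pmatrix}^-$ be a generalized inverse of it. Let $\bar\Lambda=\{\lambda_1,\dots,\lambda_{n_0}\}$ be the set of specified $n_0$ eigenvalues anywhere on the complex plane. If the conditions $$\operatorname{rank}\begin{pmatrix} FA \\ RA \\ F \\ R \end{pmatrix}=\operatorname{rank}\begin{pmatrix} F \\ R \end{pmatrix}\quad\text{and}\quad \operatorname{rank}\begin{pmatrix} sF-FA & FB \\ sR-RA & RB \end{pmatrix}=\operatorname{rank}\begin{pmatrix} F \\ R \end{pmatrix}\ \text{ for all } s\in\mathbb{C}$$ are satisfied, then the control law $u(t)=-Z\begin{pmatrix} F \\ R \end{pmatrix}x(t)$, $Z\in\mathbb{R}^{m\times n_0}$, for the system $\dot{x}(t)=Ax(t)+Bu(t)$ can place $n_0$ eigenvalues of $$\begin{pmatrix} F \\ R \end{pmatrix}A\begin{pmatrix} F \\ R \end{pmatrix}^--\begin{pmatrix} F \\ R \end{pmatrix}BZ$$ at $\bar\Lambda$, and these eigenvalues are a subset of the eigenvalues of $A-BZ\begin{pmatrix} F \\ R \end{pmatrix}$.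
   Context: The system is $\dot{x}(t)=Ax(t)+Bu(t)$ with state $x(t)\in\mathbb{R}^n$ and input $u(t)\in\mathbb{R}^m$. A generalized inverse $X^-$ of a matrix $X$ is a matrix satisfying $XX^-X=X$.
   Formalization: The set of specified eigenvalues is assumed closed under complex conjugation, counting multiplicities; this is necessary because Z is real (for instance {i, 2i} can never be the spectrum of a real 2×2 matrix). *)

(* Defs.v *)
From mathcomp Require Import all_boot all_order all_algebra.
From mathcomp Require Import complex reals.

Set Implicit Arguments.
Unset Strict Implicit.
Unset Printing Implicit Defensive.

Import Order.TTheory GRing.Theory Num.Theory.
Local Open Scope ring_scope.
Local Open Scope complex_scope.

Definition toC (R : realType) (p q : nat) (M : 'M[R]_(p, q)) : 'M[R[i]]_(p, q) :=
  map_mx (real_complex R) M.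

Definition generalized_inverse (R : realType) (p q : nat)
    (X : 'M[R]_(p, q)) (Y : 'M[R]_(q, p)) : Prop :=
  X *m Y *m X = X.

(* [s] lists the complex eigenvalues of [M], each repeated according to its
   algebraic multiplicity; the order of [s] is irrelevant. *)
Definition eigenvalue_list (R : realType) (k : nat) (M : 'M[R]_k)
    (s : seq R[i]) : Prop :=
  char_poly (toC M) = \prod_(z <- s) ('X - z%:P).

Lemma eigenvalue_listE (R : realType) (k : nat) (M : 'M[R]_k) (s : seq R[i]) :
  eigenvalue_list M s -> forall z, eigenvalue (toC M) z = (z \in s).
Proof. by move=> Ms z; rewrite eigenvalue_root_char Ms root_prod_XsubC. Qed.

(* The eigenvalues in [s] are eigenvalues of [M], as an inclusion of multisets. *)
Definition among_eigenvalues (R : realType) (k : nat) (s : seq R[i])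
    (M : 'M[R]_k) : Prop :=
  exists t : seq R[i], eigenvalue_list M (s ++ t).

(* Invariance under complex conjugation, multiplicities included: the spectrum
   of a real matrix always has this property. *)
Definition self_conjugate (R : realType) (s : seq R[i]) : Prop :=
  perm_eq [seq z^* | z <- s] s.

(* Main.v *)
(* Write W for the stacked matrix, N = W A W^- and G = W B. The first rank
   condition says that the row space of W is A-invariant, i.e. W A = N W, so the
   second one becomes the Hautus test for the pair (N, G). Poles of N - G Z are
   then placed freely: Heymann's lemma reduces to a single input, for which
   Ackermann's formula gives the feedback. Here both are carried out on the
   transposed pair (N^T, G^T), since rows are the natural vectors of the library.
   Finally W (A - B Z W) = (N - G Z) W, so the characteristic polynomial of
   N - G Z divides that of A - B Z W. *)

Require Import Defs.
From mathcomp Require Import all_boot all_order all_algebra.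
From mathcomp Require Import complex reals.

Set Implicit Arguments.
Unset Strict Implicit.
Unset Printing Implicit Defensive.

Import Order.TTheory GRing.Theory Num.Theory.
Local Open Scope ring_scope.
Local Open Scope complex_scope.

(** * Characteristic polynomials under similarity and intertwining *)

Lemma char_poly_trmx (K : comNzRingType) (k : nat) (M : 'M[K]_k) :
  char_poly M^T = char_poly M.
Proof.
rewrite /char_poly -[RHS]det_tr; congr (\det _).
by rewrite /char_poly_mx linearB /= tr_scalar_mx map_trmx.
Qed.

Lemma char_poly_conj (K : fieldType) (k : nat) (P M S : 'M[K]_k) :
  P \in unitmx -> P *m M = S *m P -> char_poly M = char_poly S.
Proof.
move=> Punit PM; have detP : \det (map_mx polyC P) != 0.
  by rewrite det_map_mx /= polyC_eq0 -unitfE -unitmxE.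
apply: (mulfI detP); rewrite /char_poly -det_mulmx mulrC -det_mulmx.
congr (\det _); rewrite /char_poly_mx mulmxBr mulmxBl -!map_mxM PM.
by rewrite scalar_mxC.
Qed.

Lemma char_poly_lblock (K : comNzRingType) (k l : nat)
    (T : 'M[K]_k) (U : 'M[K]_(l, k)) (V : 'M[K]_l) :
  char_poly (block_mx T 0 U V) = char_poly T * char_poly V.
Proof.
rewrite /char_poly -(@det_lblock _ _ _ _ (- map_mx polyC U)); congr (\det _).
rewrite /char_poly_mx map_block_mx scalar_mx_block opp_block_mx add_block_mx.
by rewrite map_mx0 oppr0 addr0 add0r.
Qed.

(* The rows of [W] extend to a basis, in which [M] is block triangular. *)
Lemma char_poly_intertwine (K : fieldType) (k n : nat)
    (W : 'M[K]_(k, n)) (M : 'M[K]_n) (T : 'M[K]_k) :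
  row_free W -> W *m M = T *m W ->
  exists2 q, q \is monic & char_poly M = char_poly T * q.
Proof.
move=> Wfree WM.
have lekn : (k <= n)%N by rewrite -(eqP Wfree) rank_leq_col.
move: Wfree WM; rewrite -(subnKC lekn) in W M *.
move: (n - k)%N W M => l W M Wfree WM.
(* At full row rank the normal form of [W] is [col_ebase W], then [(1 0)], then [row_ebase W];
   moving [col_ebase W] to the right of [(1 0)] makes it a diagonal block inside [P]. *)
have [P Punit PW] : exists2 P, P \in unitmx & row_mx 1%:M 0 *m P = W.
  exists (block_mx (col_ebase W) 0 0 1%:M *m row_ebase W).
    rewrite unitmx_mul row_ebase_unit andbT unitmxE det_lblock det1 mulr1.
    by rewrite -unitmxE col_ebase_unit.
  rewrite -[RHS]mulmx_ebase (eqP Wfree) mulmxA mul_row_block.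
  by rewrite pid_mx_row !mul1mx !mul0mx !addr0 mul_mx_row mulmx1 mulmx0.
pose S := P *m M *m invmx P.
have SP : P *m M = S *m P by rewrite mulmxKV.
have S0 : usubmx S = row_mx T 0.
  have -> : usubmx S = row_mx 1%:M 0 *m S.
    by rewrite -[in RHS](vsubmxK S) mul_row_col mul1mx mul0mx addr0.
  rewrite /S !mulmxA PW WM -PW -!mulmxA mulmxV // mulmx1.
  by rewrite mul_mx_row mulmx1 mulmx0.
exists (char_poly (drsubmx S)); first exact: char_poly_monic.
rewrite (char_poly_conj Punit SP) -(char_poly_lblock _ (dlsubmx S)).
by rewrite -[in LHS](vsubmxK S) S0 -[dsubmx S]hsubmxK.
Qed.

Lemma horner_mx_sum (K : comNzRingType) (k d : nat) (M : 'M[K]_k.+1)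
    (q : {poly K}) :
  (size q <= d)%N -> horner_mx M q = \sum_(i < d) q`_i *: M ^+ i.
Proof.
move=> sq; have {1}-> : q = \sum_(i < d) q`_i *: 'X^i.
  rewrite -poly_def; apply/polyP => i; rewrite coef_poly.
  by case: ltnP => // /(leq_trans sq) /leq_sizeP ->.
rewrite rmorph_sum; apply: eq_bigr => i _.
by rewrite /= horner_mxZ rmorphXn /= horner_mx_X.
Qed.

(** * Ackermann's formula for a single input *)

Section SingleInput.

Variables (K : fieldType) (k : nat).
Implicit Types (M : 'M[K]_k.+1) (x : 'rV[K]_k.+1) (w : 'cV[K]_k.+1).

(* Since [x M^j w] vanishes for [j < k] and is 1 for [j = k], no nonzero
   polynomial of degree at most [k] in [M] kills [w]. *)
Lemma char_poly_cyclic M x w (p : {poly K}) :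
  (forall j, (j <= k)%N -> x *m M ^+ j *m w = (j == k)%:R%:M) ->
  p \is monic -> size p = k.+2 -> horner_mx M p *m w = 0 -> char_poly M = p.
Proof.
move=> xMw pm sp pw; apply/eqP; rewrite -subr_eq0; apply/negPn/negP.
set q := _ - p => qn0.
have sq : (size q <= k.+1)%N.
  apply/leq_sizeP => j; rewrite leq_eqVlt coefB => /orP[/eqP<-|ltkj].
    have := monicP (char_poly_monic M); have := monicP pm.
    by rewrite !lead_coefE sp size_char_poly /= => -> ->; rewrite subrr.
  by rewrite !nth_default ?subrr ?sp ?size_char_poly.
have qw : horner_mx M q *m w = 0.
  by rewrite rmorphB /= Cayley_Hamilton sub0r mulNmx pw oppr0.
have sq0 : (0 < size q)%N by rewrite size_poly_gt0.
(* With [d] the degree of [q], the factor [M ^+ (k - d)] raises the leading term to [M ^+ k] and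
   keeps the others below, so only the leading coefficient survives. *)
move/(congr1 (mulmx (x *m M ^+ (k - (size q).-1)))) : qw.
rewrite mulmx0 (horner_mx_sum _ (leqnn _)) mulmx_suml mulmx_sumr.
move/matrixP/(_ 0 0); rewrite summxE -(prednK sq0) big_ord_recr /=.
have dle : ((size q).-1 <= k)%N by rewrite -ltnS prednK.
have step (i : nat) : (i <= (size q).-1)%N ->
    (x *m M ^+ (k - (size q).-1) *m (q`_i *: M ^+ i *m w)) 0 0
    = q`_i * (i == (size q).-1)%:R.
  move=> ile; rewrite -scalemxAl -scalemxAr mulmxA -(mulmxA x).
  rewrite -[M ^+ _ *m M ^+ _]exprD.
  have lek : (k - (size q).-1 + i <= k)%N
    by rewrite -[leqRHS](subnK dle) leq_add2l.
  rewrite xMw // !mxE eqxx mulr1n.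
  by rewrite -[X in _ == X](subnK dle) eqn_add2l.
rewrite big1 => [|i _]; last first.
  by rewrite step ?(ltnW (ltn_ord i)) // ltn_eqF // mulr0.
rewrite step // eqxx mulr1 add0r mxE => /eqP.
by rewrite -lead_coefE lead_coef_eq0 (negPf qn0).
Qed.

(* Ackermann's formula. *)
Lemma char_poly_ackermann M x w (p : {poly K}) :
  (forall j, (j <= k)%N -> x *m M ^+ j *m w = (j == k)%:R%:M) ->
  p \is monic -> size p = k.+2 ->
  char_poly (M - horner_mx M p *m w *m x) = p.
Proof.
move=> xMw pm sp; set g := horner_mx M p *m w; set M' := M - g *m x.
(* [M'] and [M] have the same powers up to [k] on [w], so [horner_mx M' p *m w] differs from [g]
   only through the leading term, and by exactly [- g]. *)
have M'M j : (j <= k)%N -> M' ^+ j *m w = M ^+ j *m w.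
  elim: j => [//|j IHj] ltjk; rewrite exprS -mulmxE -mulmxA IHj 1?ltnW //.
  rewrite mulmxBl -mulmxA [x *m _]mulmxA xMw 1?ltnW // ltn_eqF //.
  by rewrite raddf0 mulmx0 subr0 mulmxA exprS.
apply: (@char_poly_cyclic _ x w) => //.
  by move=> j lejk; rewrite -mulmxA M'M // mulmxA xMw.
have pk : p`_k.+1 = 1 by rewrite -(monicP pm) lead_coefE sp.
have lc N : horner_mx N p *m w
    = \sum_(i < k.+1) p`_i *: (N ^+ i *m w) + N ^+ k.+1 *m w.
  rewrite (@horner_mx_sum _ _ k.+2) ?sp // mulmx_suml big_ord_recr /= pk scale1r.
  by congr (_ + _); apply: eq_bigr => i _; rewrite scalemxAl.
rewrite lc; under eq_bigr => i _ do rewrite (M'M i (ltn_ord i)).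
rewrite exprS -mulmxE -mulmxA M'M // mulmxBl addrA -mulmxA [x *m _]mulmxA xMw //.
by rewrite eqxx mulmx1 mulmxA mulmxE -exprS -lc subrr.
Qed.

End SingleInput.

(** * Krylov matrices and Heymann's reduction to a single input *)

Definition krylov (K : fieldType) (k i : nat) (x : 'rV[K]_k.+1)
    (M : 'M[K]_k.+1) : 'M[K]_(i, k.+1) :=
  \matrix_(j < i) (x *m M ^+ j).

(** The last column of a right inverse of the Krylov matrix works. It serves both Ackermann's
    formula and the feedback change in [krylov_extend]. *)
Lemma krylov_dual (K : fieldType) (k i : nat) (x : 'rV[K]_k.+1)
    (M : 'M[K]_k.+1) : row_free (krylov i.+1 x M) ->
  exists w : 'cV[K]_k.+1,
    forall j, (j <= i)%N -> x *m M ^+ j *m w = (j == i)%:R%:M.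
Proof.
move=> Vfree; exists (col ord_max (pinvmx (krylov i.+1 x M))) => j.
rewrite -ltnS => ltj.
rewrite -(rowK (fun j : 'I_i.+1 => x *m M ^+ j) (Ordinal ltj)) -row_mul.
rewrite colE mulmxA mulmxVp // -colE; apply/matrixP => a b.
by rewrite !mxE !ord1 eqxx mulr1n.
Qed.

Section Heymann.

Variables (K : fieldType) (k m : nat) (D : 'M[K]_k.+1) (E : 'M[K]_(m, k.+1)).

(* Controllability of the pair [(D^T, E^T)]. *)
Hypothesis ctrl : forall (d : nat) (V : 'M[K]_(d, k.+1)),
  (V *m D <= V)%MS -> (E <= V)%MS -> row_full V.

(* Change the feedback only on the last Krylov row, so that its successor leaves
   the span of the others; if no change achieved this, that span would be stable
   under [D] and contain the rows of [E]. *)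
Lemma krylov_extend (u : 'rV[K]_m) (Z : 'M[K]_(k.+1, m)) (i : nat) :
  (i < k)%N -> row_free (krylov i.+1 (u *m E) (D + Z *m E)) ->
  exists Z', row_free (krylov i.+2 (u *m E) (D + Z' *m E)).
Proof.
move=> ltik; set x := u *m E; set M := D + Z *m E; set V := krylov _ _ _.
move=> Vfree.
have xV j : (j < i.+1)%N -> (x *m M ^+ j <= V)%MS.
  move=> ltj.
  by rewrite -(rowK (fun j : 'I_i.+1 => x *m M ^+ j) (Ordinal ltj)) row_sub.
have [v vV] : exists v : 'rV_m, ~~ ((x *m M ^+ i *m M + v *m E)%R <= V)%MS.
  have [xiV|xiV] := boolP (x *m M ^+ i *m M <= V)%MS; last first.
    by exists 0; rewrite mul0mx addr0.
  have [EV|/row_subPn[a Ea]] := boolP (E <= V)%MS; last first.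
    exists (delta_mx 0 a); rewrite -rowE; apply: contra Ea => xEV.
    by rewrite -(addKr (x *m M ^+ i *m M) (row a E)) addmx_sub ?eqmx_opp.
  have VM : (V *m M <= V)%MS.
    apply/row_subP => j; rewrite row_mul rowK -mulmxA mulmxE -exprSr.
    have := ltn_ord j; rewrite ltnS leq_eqVlt => /orP[/eqP->|ltj]; last exact: xV.
    by rewrite exprSr -mulmxE mulmxA.
  have VD : (V *m D <= V)%MS.
    have -> : V *m D = V *m M - V *m Z *m E.
      by rewrite mulmxDr mulmxA addrK.
    by rewrite addmx_sub // eqmx_opp mulmx_sub.
  have := ctrl VD EV; rewrite /row_full (eqP Vfree) eqSS => /eqP ik.
  by rewrite ik ltnn in ltik.
have [c xc] := krylov_dual Vfree.
(* Every Krylov row but the last kills [c], so adding [c *m v] to the feedback alters only the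
   successor of the last row, by [v *m E]. *)
exists (Z + c *m v); set M' := D + _.
have M'E : M' = M + c *m v *m E by rewrite /M' mulmxDl addrA.
have xM' j : (j <= i)%N -> x *m M' ^+ j = x *m M ^+ j.
  elim: j => [//|j IHj] ltji; rewrite exprSr -mulmxE mulmxA IHj 1?ltnW //.
  rewrite M'E mulmxDr !mulmxA xc 1?ltnW // ltn_eqF // raddf0 !mul0mx addr0.
  by rewrite -mulmxA mulmxE -exprSr.
have xM'i : x *m M' ^+ i.+1 = x *m M ^+ i *m M + v *m E.
  rewrite exprSr -mulmxE mulmxA xM' // M'E mulmxDr !mulmxA xc // eqxx.
  by rewrite mul1mx.
apply: inj_row_free => y; rewrite mulmx_sum_row big_ord_recr /= rowK xM'i.
set s := \sum_(_ < _) _ => ys.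
have sE : s = (\row_j y 0 (widen_ord (leqnSn _) j)) *m V.
  rewrite mulmx_sum_row; apply: eq_bigr => j _.
  by rewrite !rowK mxE /= xM' // -ltnS.
have y0 : y 0 ord_max = 0.
  apply/eqP/negPn/negP => yn0; move/negP: vV; apply.
  move/eqP: ys; rewrite addrC addr_eq0 -(eqmx_scale _ yn0) => /eqP->.
  by rewrite eqmx_opp sE submxMl.
move: ys; rewrite y0 scale0r addr0 sE => /eqP.
rewrite mulmx_free_eq0 // => /eqP ys.
apply/rowP => j; rewrite mxE.
case: (unliftP ord_max j) => [j' ->|->//].
have := congr1 (fun z : 'rV_i.+1 => z 0 j') ys; rewrite !mxE => <-.
by congr (y 0 _); apply: val_inj; rewrite /= /bump leqNgt ltn_ord.
Qed.

(** Independent Krylov rows are gained one at a time from a nonzero [u *m E], which exists because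
    controllability applied to [V = 0] excludes [E = 0]. *)
Lemma heymann : exists (u : 'rV[K]_m) (Z : 'M[K]_(k.+1, m)),
  row_free (krylov k.+1 (u *m E) (D + Z *m E)).
Proof.
have [u uE] : exists u : 'rV_m, u *m E != 0.
  have /row_subPn[a Ea] : ~~ (E <= (0 : 'M[K]_(1, k.+1)))%MS.
    apply/negP => E0; have := @ctrl 1%N 0; rewrite mul0mx submx_refl => /(_ isT E0).
    by rewrite /row_full mxrank0.
  exists (delta_mx 0 a); rewrite -rowE.
  by apply: contra Ea => /eqP->; exact: sub0mx.
exists u; suff H i : (i <= k)%N -> exists Z : 'M_(k.+1, m),
  row_free (krylov i.+1 (u *m E) (D + Z *m E)) by exact: H.
elim: i => [_|i IHi ltik].
  exists 0; apply: inj_row_free => y; rewrite mulmx_sum_row big_ord1 rowK mulmx1.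
  move/eqP; rewrite scaler_eq0 (negPf uE) orbF => /eqP y0.
  by apply/rowP => j; rewrite ord1 y0 mxE.
by have [Z Zfree] := IHi (ltnW ltik); apply: krylov_extend Zfree.
Qed.

(** Ackermann's correction is a column times [u *m E], hence itself a feedback through [E]. *)
Lemma pole_placement_rows (p : {poly K}) : p \is monic -> size p = k.+2 ->
  exists Z : 'M[K]_(k.+1, m), char_poly (D + Z *m E) = p.
Proof.
move=> pm sp; have [u [Z Vfree]] := heymann.
set M := D + Z *m E in Vfree; set x := u *m E in Vfree.
have [w xw] := krylov_dual Vfree.
exists (Z - horner_mx M p *m w *m u).
by rewrite mulmxBl addrA -[_ *m u *m E]mulmxA; apply: char_poly_ackermann.
Qed.

End Heymann.

(** * Hautus test, real polynomials and final assembly *)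

(* The Popov-Belevitch-Hautus test: a proper [N^T]-stable subspace containing
   the rows of [G^T] has a nonzero annihilator, which is stable under [N] and
   so contains a complex left eigenvector of [N] that kills [G]. *)
Lemma hautus_controllable (R : realType) (k m : nat)
    (N : 'M[R]_k) (G : 'M[R]_(k, m)) :
  (forall s : R[i], row_free (row_mx (s%:M - toC N) (toC G))) ->
  forall (d : nat) (V : 'M[R]_(d, k)),
    (V *m N^T <= V)%MS -> (G^T <= V)%MS -> row_full V.
Proof.
move=> pbh d V /submxP[X VN] /submxP[Y GV]; apply/negPn/negP => Vnfull.
pose L := row_base (kermx V^T).
have LV : L *m V^T = 0 by apply/sub_kermxP; rewrite eq_row_base.
have LG : L *m G = 0 by rewrite -[G]trmxK GV trmx_mul mulmxA LV mul0mx.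
have /submxP[T LN] : (L *m N <= L)%MS.
  rewrite eq_row_base; apply/sub_kermxP.
  have NV : N *m V^T = V^T *m X^T by rewrite -trmx_mul -VN trmx_mul trmxK.
  by rewrite -mulmxA NV mulmxA LV mul0mx.
have rk0 : (0 < \rank (kermx V^T))%N.
  rewrite mxrank_ker subn_gt0 mxrank_tr ltn_neqAle rank_leq_col andbT.
  exact: Vnfull.
have [a /eigenvalueP[y yT yn0]] := eigenvalue_closed (toC T) rk0.
have LNC : toC L *m toC N = toC T *m toC L by rewrite /toC -!map_mxM LN.
have LGC : toC L *m toC G = 0 by rewrite /toC -map_mxM LG map_mx0.
have y0 : y *m toC L *m row_mx (a%:M - toC N) (toC G) = 0.
  rewrite mul_mx_row mulmxBr -!mulmxA LNC LGC mulmx0 mul_mx_scalar.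
  by rewrite [y *m (toC T *m _)]mulmxA yT -scalemxAl -scalemxAr subrr row_mx0.
move/eqP: y0; rewrite mulmx_free_eq0 // mulmx_free_eq0 ?(negPf yn0) //.
by rewrite row_free_map row_base_free.
Qed.

(** Conjugation permutes the linear factors, so the coefficients of the product are real. This gives
    a real target polynomial for a real feedback. *)
Lemma self_conjugate_real_poly (R : realType) (s : seq R[i]) :
  self_conjugate s ->
  exists2 p : {poly R}, p \is monic &
    map_poly (real_complex R) p = \prod_(z <- s) ('X - z%:P).
Proof.
move=> sconj; set P := \prod_(z <- s) _.
have conjP : map_poly conjc P = P.
  rewrite rmorph_prod /= -[RHS](perm_big _ sconj) /= big_map.
  by apply: eq_bigr => z _; rewrite rmorphB /= map_polyX map_polyC.
pose p := map_poly (@complex.Re R) P.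
have pP : map_poly (real_complex R) p = P.
  apply/polyP => j; rewrite coef_map coef_map_id0 //=.
  have := congr1 (fun q : {poly R[i]} => q`_j) conjP; rewrite coef_map /=.
  case: (P`_j) => a b [/eqP]; rewrite eq_sym -addr_eq0 => bb.
  by have -> : b = 0 by apply/eqP; move: bb; rewrite -mulr2n mulrn_eq0.
by exists p => //; rewrite -(map_monic (real_complex R)) pP monic_prod_XsubC.
Qed.

Theorem corollary5 (R : realType) (n m r n0 : nat)
    (A : 'M[R]_n) (B : 'M[R]_(n, m))
    (F : 'M[R]_(r, n)) (R0 : 'M[R]_(n0 - r, n))
    (FRinv : 'M[R]_(n, r + (n0 - r)))
    (Lambda : n0.-tuple R[i])
    (hr : (r < n0)%N) (hn : (n0 <= n)%N)
    (hfull : row_free (col_mx F R0))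
    (hinv : generalized_inverse (col_mx F R0) FRinv)
    (hconj : self_conjugate Lambda)
    (hrank1 : \rank (col_mx (col_mx (F *m A) (R0 *m A)) (col_mx F R0))
              = \rank (col_mx F R0))
    (hrank2 : forall s : R[i],
       \rank (block_mx (s *: toC F - toC (F *m A)) (toC (F *m B))
                       (s *: toC R0 - toC (R0 *m A)) (toC (R0 *m B)))
       = \rank (col_mx F R0)) :
  exists Z : 'M[R]_(m, r + (n0 - r)),
    eigenvalue_list
      (col_mx F R0 *m A *m FRinv - col_mx F R0 *m B *m Z) Lambda
    /\ among_eigenvalues Lambda (A - B *m Z *m col_mx F R0).
Proof.
have [p pm pL] := self_conjugate_real_poly hconj.
have sp : size p = (r + (n0 - r)).+1.
  rewrite -(size_map_poly (real_complex R)) pL size_prod_XsubC size_tuple.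
  by rewrite subnKC // ltnW.
set W := col_mx F R0 in hfull hinv hrank1 hrank2 *.
set N := W *m A *m FRinv.
have WK : W *m FRinv = 1%:M.
  by apply: (row_free_inj hfull); rewrite mul1mx.
have NW : W *m A = N *m W.
  have /submxP[X XW] : (W *m A <= W)%MS.
    rewrite -mul_col_mx -/W in hrank1.
    have sub : (W <= col_mx (W *m A) W)%MS by rewrite -(addsmxE (W *m A)) addsmxSr.
    have := mxrank_leqif_sup sub; rewrite hrank1 => -[_].
    by rewrite eqxx -(addsmxE (W *m A)) addsmx_sub => /esym/andP[].
  by rewrite /N XW -(mulmxA X) WK mulmx1.
have pbh (s : R[i]) : row_free (row_mx (s%:M - toC N) (toC (W *m B))).
  have := hrank2 s.
  (* The product has rank equal to the number of rows of [W], which forces its left factor, the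
     Hautus matrix, to have full row rank. *)
  have -> : block_mx (s *: toC F - toC (F *m A)) (toC (F *m B))
        (s *: toC R0 - toC (R0 *m A)) (toC (R0 *m B))
     = row_mx (s%:M - toC N) (toC (W *m B)) *m block_mx (toC W) 0 0 1%:M.
    rewrite mul_row_block !mulmx0 mulmx1 addr0 add0r mulmxBl mul_scalar_mx.
    rewrite /toC -map_mxM -NW /W !mul_col_mx !map_col_mx.
    by rewrite scale_col_mx opp_col_mx add_col_mx block_mxEh.
  rewrite (eqP hfull) => /eqP.
  rewrite eqn_leq => /andP[_ le].
  by rewrite /row_free eqn_leq rank_leq_row (leq_trans le) // mxrankM_maxl.
have [Z Zp] : exists Z : 'M[R]_(m, r + (n0 - r)), char_poly (N - W *m B *m Z) = p.
  have := hautus_controllable pbh.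
  have k0 : (0 < r + (n0 - r))%N by rewrite subnKC ?(leq_ltn_trans _ hr) // ltnW.
  move: sp (W *m B) (N) k0; case: (r + (n0 - r))%N => // k sp' G N' _ ctrl.
  have [Y Yp] := pole_placement_rows ctrl pm sp'.
  (* Transposing [N'^T + Y *m G^T] gives [N' + G *m Y^T], hence the sign. *)
  exists (- Y^T); rewrite -Yp -[RHS]char_poly_trmx linearD /= trmx_mul !trmxK.
  by rewrite mulmxN opprK.
exists Z; have eigN : eigenvalue_list (N - W *m B *m Z) Lambda.
  by rewrite /eigenvalue_list -map_char_poly Zp pL.
split=> //.
have WM : W *m (A - B *m Z *m W) = (N - W *m B *m Z) *m W.
  by rewrite mulmxBr mulmxBl NW !mulmxA.
have [q qm qE] := char_poly_intertwine hfull WM.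
(* The complex roots of the cofactor [q] are the remaining eigenvalues of the closed loop. *)
have [t tE] := closed_field_poly_normal (map_poly (real_complex R) q).
exists t; rewrite /eigenvalue_list -map_char_poly qE rmorphM /= Zp pL big_cat /=.
congr (_ * _); rewrite tE.
by rewrite (monicP _) ?scale1r // map_monic.
Qed.
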